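(* Let $0<p<q$ be constants. There is a constant $c=c(p,q)>0$ such that the following holds. Consider any sequence of random allocation instances with $n\to\infty$ agents and $m=m(n)$ items satisfying $m\ge c\, n\log n/\log\log n$ for all sufficiently large $n$ (i.e. $m\in\Omega(n\log n/\log\log n)$), where the utility distributions $\mathcal{D}_1,\dots,\mathcal{D}_n$ (which may vary arbitrarily with the agent and with $n$) all have interval support and are $(p,q)$-PDF-bounded, and the utilities $u_i(\alpha)\sim\mathcal{D}_i$ are drawn independently over all agents $i$ and items $\alpha$. Then, with probability converging to $1$ as $n\to\infty$, an envy-free allocation exists.
   Context: Setting: a set $M$ of $m$ indivisible items is allocated to agents $N=\{1,\dots,n\}$. Agent $i$ has utility $u_i(\alpha)\ge 0$ for item $\alpha$, and utilities are additive: $u_i(A)=\sum_{\alpha\in A}u_i(\alpha)$ for $A\subseteq M$. An allocation is a partition $M=A_1\cup\dots\cup A_n$ into bundles, agent $i$ receiving $A_i$. It is envy-free if $u_i(A_i)\ge u_i(A_j)$ for all $i,j\in N$. Asymmetric model: each agent $i$ has a nonatomic probability distribution $\mathcal{D}_i$ on $[0,1]$ (its utility distribution), and all $u_i(\alpha)$ are independent with $u_i(\alpha)\sim\mathcal{D}_i$. Interval support: the support of $\mathcal{D}_i$ is an interval $[a_i,b_i]$ with $0\le a_i<b_i\le 1$. $(p,q)$-PDF-bounded: $\mathcal{D}_i$ has a probability density function that lies between $p$ and $q$ on the support of $\mathcal{D}_i$. *)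

(* Defs.v *)
From HB Require Import structures.
From mathcomp Require Import all_boot all_order all_algebra.
From mathcomp Require Import all_classical all_reals all_analysis.
Set Implicit Arguments.
Unset Strict Implicit.
Unset Printing Implicit Defensive.
Import Order.TTheory GRing.Theory Num.Theory.
Import numFieldNormedType.Exports.
Local Open Scope classical_set_scope.
Local Open Scope ring_scope.

(* Bundles may be empty. *)
Definition allocation (n m : nat) (A : {ffun 'I_n -> {set 'I_m}}) : Prop :=
  (forall i j : 'I_n, i != j -> (A i :&: A j = finset.set0)%SET) /\
  (\bigcup_i A i = [set: 'I_m])%SET.

Definition bundle_utility (R : realType) (n m : nat) (u : 'I_n -> 'I_m -> R)
    (i : 'I_n) (B : {set 'I_m}) : R :=
  \sum_(a in B) u i a.

Definition envy_free (R : realType) (n m : nat) (u : 'I_n -> 'I_m -> R)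
    (A : {ffun 'I_n -> {set 'I_m}}) : Prop :=
  forall i j : 'I_n, bundle_utility u i (A j) <= bundle_utility u i (A i).

Definition envy_free_allocation_exists (R : realType) (n m : nat)
    (u : 'I_n -> 'I_m -> R) : Prop :=
  exists A : {ffun 'I_n -> {set 'I_m}}, allocation A /\ envy_free u A.

(* Topological support: the points all of whose open neighbourhoods have
   positive mass. *)
Definition mass_support (R : realType) (D : probability R R)
    : set R :=
  [set x | forall V : set R, open V -> V x -> (0 < D V)%E].

Definition utility_distribution (R : realType)
    (D : probability R R) : Prop :=
  D `[0, 1]%classic = 1%E /\ forall x : R, D [set x] = 0%E.

Definition interval_support (R : realType)
    (D : probability R R) : Prop :=
  exists a b : R, [/\ 0 <= a, a < b, b <= 1 & mass_support D = `[a, b]%classic].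

Definition has_density (R : realType)
    (D : probability R R) (f : R -> R) : Prop :=
  [/\ measurable_fun setT f, forall x, 0 <= f x &
      forall B : set R, measurable B ->
        D B = (\int[@lebesgue_measure R]_(x in B) (f x)%:E)%E].

Definition pdf_bounded (R : realType) (p q : R)
    (D : probability R R) : Prop :=
  exists f : R -> R, has_density D f /\
    forall x, mass_support D x -> p <= f x <= q.

Definition mutually_independent (d : measure_display) (T : measurableType d)
    (R : realType) (P : probability T R) (I : finType)
    (X : I -> {RV P >-> R}) : Prop :=
  forall (J : {set I}) (B : I -> set R),
    (forall i, i \in J -> measurable (B i)) ->
    P (\bigcap_(i in [set` J]) (X i @^-1` B i)) =
    (\prod_(i in J) P (X i @^-1` B i))%E.

Definition envy_free_event (d : measure_display) (T : measurableType d)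
    (R : realType) (P : probability T R) (n m : nat)
    (U : 'I_n -> 'I_m -> {RV P >-> R}) : set T :=
  [set w | envy_free_allocation_exists (fun i a => U i a w)].

Lemma measurable_envy_free_event (d : measure_display) (T : measurableType d)
    (R : realType) (P : probability T R) (n m : nat)
    (U : 'I_n -> 'I_m -> {RV P >-> R}) : measurable (envy_free_event U).
Proof.
rewrite (_ : envy_free_event U =
  \bigcup_(A in [set A | allocation A])
    \bigcap_(ij in [set: 'I_n * 'I_n])
      [set w | bundle_utility (fun i a => U i a w) ij.1 (A ij.2) <=
               bundle_utility (fun i a => U i a w) ij.1 (A ij.1)]); last first.
  apply/seteqP; split=> w /=.
    by case=> A [aA efA]; exists A => // -[i j] _ /=; exact: efA.
  by case=> A aA efA; exists A; split=> // i j; exact: (efA (i, j)).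
apply: fin_bigcup_measurable => [|A _]; first exact: finite_finset.
apply: fin_bigcap_measurable => [|[i j] _ /=]; first exact: finite_finset.
have mU (B : {set 'I_m}) :
    measurable_fun setT (fun w => bundle_utility (fun i a => U i a w) i B).
  by rewrite /bundle_utility; under eq_fun do rewrite big_mkcond /=;
     apply: measurable_sum => a; case: (a \in B).
rewrite -[X in measurable X]setTI.
exact: (measurable_fun_le measurableT (mU (A j)) (mU (A i))).
Qed.

(* Main.v *)
Require Import Defs.
From HB Require Import structures.
From mathcomp Require Import all_boot all_order all_algebra.
From mathcomp Require Import all_classical all_reals all_analysis.
From mathcomp Require Import measurable_realfun zify ring lra.
Set Implicit Arguments.
Unset Strict Implicit.
Unset Printing Implicit Defensive.
Import Order.TTheory GRing.Theory Num.Theory.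
Import numFieldNormedType.Exports.
Local Open Scope ring_scope.

(* The round-robin allocation is envy-free with high probability.

   Utilities are rounded to cells of width 1/N, with N huge, which turns the
   joint law into a product of finite laws.  After each pick of agent [i],
   compare it with the next pick of agent [j]: the pick of [i] is at least as
   good for [i], and given the history the item taken by [j] has, for [i], its
   original law conditioned on lying below the pick of [i].  While at least half
   of the items remain, the pick of [i] stays above a low quantile, so the gap is
   less than 2/B with conditional probability O(q/B), and at least B of the first
   2B gaps are this small with probability at most (256 q/B)^B.  Otherwise the
   gaps add up to 2, more than the item [j] may have taken before the first
   pick of [i] and all rounding errors.  With B ~ 12 log n / log log n the
   bound (256 q/B)^B is at most n^-3, which beats the union bound over the pairs
   of agents. *)

(** * Finite product measures *)

Section ProductWeight.
Context {R : realFieldType} {C Z : finType}.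
Variable w : C -> Z -> R.
Hypothesis w_ge0 : forall c z, 0 <= w c z.
Hypothesis sum_w : forall c, \sum_z w c z = 1.

Definition upd (k : {ffun C -> Z}) (c : C) (z : Z) : {ffun C -> Z} :=
  [ffun c' => if c' == c then z else k c'].

Lemma updE k c z : upd k c z c = z.
Proof. by rewrite ffunE eqxx. Qed.

Lemma updNE k c z c' : c' != c -> upd k c z c' = k c'.
Proof. by rewrite ffunE => /negbTE ->. Qed.

Lemma upd_upd k c z z' : upd (upd k c z) c z' = upd k c z'.
Proof. by apply/ffunP => c'; rewrite !ffunE; case: eqP. Qed.

Lemma upd_id k c : upd k c (k c) = k.
Proof. by apply/ffunP => c'; rewrite !ffunE; case: eqP => // ->. Qed.

Definition weight (k : {ffun C -> Z}) : R := \prod_c w c (k c).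

Definition Pr (E : pred {ffun C -> Z}) : R := \sum_(k | E k) weight k.

Lemma weight_ge0 k : 0 <= weight k.
Proof. by apply: prodr_ge0 => c _; exact: w_ge0. Qed.

Lemma Pr_all : Pr predT = 1.
Proof.
rewrite /Pr /weight -(bigA_distr_bigA (fun c z => w c z)) /=.
by apply: big1 => c _; exact: sum_w.
Qed.

Lemma Pr_sum E : Pr E = \sum_k weight k * (E k)%:R.
Proof.
by rewrite /Pr big_mkcond /=; apply: eq_bigr => k _; case: (E k); rewrite ?mulr1 ?mulr0.
Qed.

Lemma Pr_le (E F : pred {ffun C -> Z}) : (forall k, E k -> F k) -> Pr E <= Pr F.
Proof.
move=> EF; rewrite !Pr_sum; apply: ler_sum => k _.
apply: ler_wpM2l; first exact: weight_ge0.
by move: (EF k); case: (E k) => [/(_ isT) ->|_]; rewrite ?ler0n.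
Qed.

Lemma Pr_union (J : finType) (Q : pred J) (E : pred {ffun C -> Z})
    (F : J -> pred {ffun C -> Z}) :
  (forall k, E k -> exists2 j, Q j & F j k) -> Pr E <= \sum_(j | Q j) Pr (F j).
Proof.
move=> EF; rewrite Pr_sum; under [leRHS]eq_bigr do rewrite Pr_sum.
rewrite exchange_big /=; apply: ler_sum => k _; rewrite -mulr_sumr.
apply: ler_wpM2l; first exact: weight_ge0.
case Ek: (E k); last by apply: sumr_ge0 => j _; exact: ler0n.
have [j Qj Fj] := EF k Ek.
by rewrite (bigD1 j) //= Fj lerDl; apply: sumr_ge0 => j' _; exact: ler0n.
Qed.

Lemma Pr_compl E : Pr E = 1 - Pr (predC E).
Proof.
rewrite -Pr_all /Pr (bigID E predT) /=.
by rewrite addrK.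
Qed.

Lemma Pr_rect (A : {set C}) (Q : C -> pred Z) :
  Pr (fun k => [forall c in A, Q c (k c)]) = \prod_(c in A) \sum_(z | Q c z) w c z.
Proof.
pose f c z := if (c \in A) ==> Q c z then w c z else 0.
transitivity (\prod_c \sum_z f c z).
  rewrite bigA_distr_bigA /= Pr_sum; apply: eq_bigr => k _.
  case: (boolP [forall c in A, Q c (k c)]) => [/forallP/= h|].
    by rewrite mulr1; apply: eq_bigr => c _; rewrite /f h.
  rewrite negb_forall => /existsP[c hc].
  by rewrite mulr0 (bigD1 c) //= /f (negbTE hc) mul0r.
rewrite [RHS]big_mkcond /=; apply: eq_bigr => c _; rewrite /f.
by case: (c \in A) => /=; [rewrite [RHS]big_mkcond|exact: sum_w].
Qed.

(** Redrawing coordinate [c] preserves the law: the involution that exchanges [k c] with an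
    independent sample [z] leaves [weight k * w c z] unchanged. *)
Lemma resample (c : C) (F : {ffun C -> Z} -> R) :
  \sum_k weight k * F k = \sum_k weight k * \sum_z w c z * F (upd k c z).
Proof.
pose W' (k : {ffun C -> Z}) := \prod_(c' | c' != c) w c' (k c').
have WE k : weight k = w c (k c) * W' k by rewrite /weight (bigD1 c).
have W'E k z : W' (upd k c z) = W' k.
  by apply: eq_bigr => c' ne; rewrite updNE.
pose sw (p : {ffun C -> Z} * Z) := (upd p.1 c p.2, p.1 c).
have swK : involutive sw by case=> k z; rewrite /sw /= updE upd_upd upd_id.
transitivity (\sum_(p : {ffun C -> Z} * Z) weight p.1 * w c p.2 * F p.1).
  rewrite -(pair_bigA _ (fun k z => weight k * w c z * F k)) /=.
  apply: eq_bigr => k _; under eq_bigr do rewrite mulrAC.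
  by rewrite -mulr_sumr sum_w mulr1.
rewrite (reindex_inj (inv_inj swK)) /=.
under [RHS]eq_bigr do rewrite mulr_sumr.
rewrite [RHS](pair_bigA _ (fun k z => weight k * (w c z * F (upd k c z)))) /=.
apply: eq_bigr => -[k z] _ /=.
by rewrite !WE updE W'E; ring.
Qed.

(** The coordinate to redraw depends on the profile, so the space is first split by its value [c].
    The hypothesis is the conditional bound on each fibre where only coordinate [c] varies. *)
Lemma Pr_resample (crd : {ffun C -> Z} -> C) (E S : pred {ffun C -> Z}) (r : R) :
  (forall c k, \sum_(z | let k' := upd k c z in [&& E k', crd k' == c & S k']) w c z
               <= r * \sum_(z | let k' := upd k c z in E k' && (crd k' == c)) w c z) ->
  Pr (fun k => E k && S k) <= r * Pr E.
Proof.
move=> H.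
have split_crd (G : pred {ffun C -> Z}) :
    Pr G = \sum_c \sum_k weight k * (G k && (crd k == c))%:R.
  rewrite Pr_sum exchange_big /=; apply: eq_bigr => k _.
  rewrite -mulr_sumr (bigD1 (crd k)) //= eqxx andbT big1 ?addr0 // => c.
  by rewrite eq_sym => /negbTE ->; rewrite andbF.
rewrite !split_crd mulr_sumr; apply: ler_sum => c _.
rewrite (resample c) [X in _ <= r * X](resample c) mulr_sumr; apply: ler_sum => k _.
rewrite mulrCA; apply: ler_wpM2l; first exact: weight_ge0.
have sumE (G : pred Z) : \sum_z w c z * (G z)%:R = \sum_(z | G z) w c z.
  by rewrite [RHS]big_mkcond /=; apply: eq_bigr => z _; case: (G z); rewrite ?mulr1 ?mulr0.
rewrite !sumE; apply: le_trans (H c k); rewrite le_eqVlt; apply/orP; left; apply/eqP.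
by apply: eq_bigl => z /=; rewrite -andbA; congr (_ && _); rewrite andbC.
Qed.

End ProductWeight.

(* Given the other coordinates, the coordinate [crd k] has its law conditioned on
   an event lying between [< x k] and [<= x k]. *)
Lemma Pr_small_gap (R : realFieldType) (C : finType) (N h : nat)
    (w : C -> 'I_N.+1 -> R) (r : R) (crd : {ffun C -> 'I_N.+1} -> C)
    (x : {ffun C -> 'I_N.+1} -> nat) (E : pred {ffun C -> 'I_N.+1}) :
  (forall c z, 0 <= w c z) -> (forall c, \sum_z w c z = 1) -> 0 <= r ->
  (forall k, E k -> (0 < x k)%N) ->
  (forall k, E k -> (k (crd k) <= x k)%N) ->
  (forall k (z : 'I_N.+1), E k -> (z < x k)%N ->
     let k' := upd k (crd k) z in [/\ E k', crd k' = crd k & x k' = x k]) ->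
  (forall k, E k -> \sum_(z : 'I_N.+1 | (z <= x k < z + h)%N) w (crd k) z
                <= r * \sum_(z : 'I_N.+1 | (z < x k)%N) w (crd k) z) ->
  Pr w (fun k => E k && (x k < k (crd k) + h)%N) <= r * Pr w E.
Proof.
move=> w_ge0 sum_w r_ge0 x_gt0 le_x Eupd wle.
apply: (Pr_resample w_ge0 sum_w (crd := crd) (S := fun k => (x k < k (crd k) + h)%N)) => c k.
case: (pickP (fun z => E (upd k c z) && (crd (upd k c z) == c))) => [z0|none]; last first.
  rewrite big_pred0 ?mulr_ge0 ?sumr_ge0 // => z /=.
  by move: (none z); case: (E _) => //= ->.
case/andP=> E0 /eqP c0; set k0 := upd k c z0 in E0 c0.
have le0 := wle _ E0.
have stay (z : 'I_N.+1) : (z < x k0)%N -> [/\ E (upd k c z), crd (upd k c z) = c & x (upd k c z) = x k0].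
  by move=> lt; have := Eupd k0 z E0 lt; rewrite c0 /k0 upd_upd.
(* The value of [x] is constant on the fibre: lowering coordinate [c] to cell 0, allowed since [x]
   is positive, keeps [x] and leads every such profile to the same one. *)
have samex (z : 'I_N.+1) : E (upd k c z) -> crd (upd k c z) = c -> x (upd k c z) = x k0.
  move=> Ez cz; have [_ _ <-] := stay ord0 (x_gt0 _ E0).
  by have [_ _] := Eupd _ ord0 Ez (x_gt0 _ Ez); rewrite cz upd_upd.
apply: (@le_trans _ _ (\sum_(z : 'I_N.+1 | (z <= x k0 < z + h)%N) w c z)).
  rewrite big_mkcond [leRHS]big_mkcond /=; apply: ler_sum => z _.
  case: ifP => [/and3P[Ez /eqP cz]|_]; last by case: ifP.
  by have := le_x _ Ez; rewrite (samex _ Ez cz) cz updE => -> ->.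
rewrite c0 in le0; apply: (le_trans le0); apply: ler_wpM2l => //.
rewrite big_mkcond [leRHS]big_mkcond /=; apply: ler_sum => z _.
case: ifP => [lt|_]; last by case: ifP.
by have [-> -> _] := stay z lt; rewrite eqxx.
Qed.

(** * The round-robin process *)

Section RoundRobin.
Local Open Scope nat_scope.
Context {n m : nat}.
Implicit Types (f g : 'I_m.+1 -> nat) (S : {set 'I_m.+1})
  (v : 'I_n.+1 -> 'I_m.+1 -> nat).

(* Ties are broken by the index of the item. *)
Definition key f (a : 'I_m.+1) : nat := f a * m.+1 + a.

Lemma key_inj f : injective (key f).
Proof.
move=> a b; rewrite /key => eq_key; apply: val_inj => /=.
by move: (congr1 (modn^~ m.+1) eq_key); rewrite !modnMDl !modn_small.
Qed.

(** The default [ord0] is returned only when [S] is empty. *)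
Definition best f S : 'I_m.+1 :=
  odflt ord0 [pick a in S | [forall b in S, key f b <= key f a]].

Lemma best_unique f S a :
  a \in S -> (forall b, b \in S -> key f b <= key f a) -> best f S = a.
Proof.
move=> aS amax; rewrite /best; case: pickP => [b /andP[bS /forall_inP bmax]|/(_ a)] /=.
  by apply: (@key_inj f); apply/eqP; rewrite eqn_leq amax // bmax.
by rewrite aS /=; case: forall_inP => // -[].
Qed.

Lemma bestP f S : S != finset.set0 ->
  best f S \in S /\ forall b, b \in S -> key f b <= key f (best f S).
Proof.
case/set0Pn => a0 a0S; case: (@arg_maxnP _ a0 (mem S) (key f) a0S) => a aS amax.
by rewrite (best_unique aS).
Qed.

Lemma best_max f S b : b \in S -> f b <= f (best f S).
Proof.
move=> bS; have [|_ /(_ b bS)] := @bestP f S; first by apply/set0Pn; exists b.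
rewrite /key; move: (ltn_ord b) (ltn_ord (best f S)); nia.
Qed.

(** The old winner keeps its value because it is not [r], and a strict inequality of values decides
    between it and [r] whatever the tie-break. *)
Lemma best_stable f g S r :
  (forall a, a != r -> f a = g a) -> r \in S -> r != best f S ->
  g r < f (best f S) -> best g S = best f S.
Proof.
move=> fg rS ne lt; have [|bS bmax] := @bestP f S; first by apply/set0Pn; exists r.
apply: best_unique => // b bS'; case: (eqVneq b r) => [->|nb].
  by rewrite /key -(fg (best f S)) 1?eq_sym //; move: (ltn_ord r); nia.
by rewrite /key -!fg 1?[best _ _ == _]eq_sym //; exact: bmax.
Qed.

(** Step [s], counted from 0, is the turn of agent [s] modulo [n.+1]. Only the first [m.+1] steps
    hand out items. *)
Fixpoint avail v (s : nat) : {set 'I_m.+1} :=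
  if s is s'.+1 then avail v s' :\ best (v (inZp s')) (avail v s') else [set: 'I_m.+1].

Definition chosen v s : 'I_m.+1 := best (v (inZp s)) (avail v s).

Lemma availS v s : avail v s.+1 = avail v s :\ chosen v s.
Proof. by []. Qed.

Lemma avail_sub v s s' : s <= s' -> avail v s' \subset avail v s.
Proof.
elim: s' => [|s' IH]; first by rewrite leqn0 => /eqP ->.
rewrite leq_eqVlt => /orP[/eqP -> //|lt].
by rewrite availS; apply: fintype.subset_trans (IH lt); rewrite subD1set.
Qed.

Lemma card_avail v s : s <= m.+1 -> #|avail v s| = m.+1 - s.
Proof.
elim: s => [_|s IH lt]; first by rewrite cardsT card_ord subn0.
have := IH (ltnW lt); rewrite availS (cardsD1 (chosen v s) (avail v s)).
have -> : chosen v s \in avail v s.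
  by have [] := @bestP (v (inZp s)) (avail v s); rewrite // -card_gt0 IH ?subn_gt0 // ltnW.
by rewrite add1n subnS => <-.
Qed.

Lemma chosen_avail v s : s < m.+1 -> chosen v s \in avail v s.
Proof.
by move=> lt; have [] := @bestP (v (inZp s)) (avail v s);
  rewrite // -card_gt0 card_avail ?subn_gt0 // ltnW.
Qed.

Lemma chosen_avail_le v s s' : s <= s' -> s' < m.+1 -> chosen v s' \in avail v s.
Proof. by move=> le lt; apply: (fintype.subsetP (avail_sub v le)); exact: chosen_avail. Qed.

Lemma chosen_neq v s s' : s < s' -> s' < m.+1 -> chosen v s' != chosen v s.
Proof.
move=> lt lt'; have := chosen_avail_le v lt lt'.
by rewrite availS !inE => /andP[].
Qed.

Lemma chosen_inj v : injective (fun s : 'I_m.+1 => chosen v s).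
Proof.
move=> s s' eq_c; apply: val_inj; case: (ltngtP s s') => // lt.
  by have := chosen_neq v lt (ltn_ord s'); rewrite eq_c eqxx.
by have := chosen_neq v lt (ltn_ord s); rewrite eq_c eqxx.
Qed.

(** Whatever is taken later was still available at the turn of [i]. *)
Lemma chosen_max v i s s' : inZp s = i -> s <= s' -> s' < m.+1 ->
  v i (chosen v s') <= v i (chosen v s).
Proof. by move=> <- le lt; apply: best_max; exact: chosen_avail_le. Qed.

(* Between two picks of agent [i] the process does not look at [v i], so lowering an
   item chosen there below the last pick of [i] changes nothing up to that time. *)
Lemma chosen_stable v v' i s s' : inZp s = i -> s < s' -> s' < m.+1 ->
  (forall s'', s < s'' <= s' -> inZp s'' <> i) ->
  (forall j a, (j, a) != (i, chosen v s') -> v' j a = v j a) ->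
  v' i (chosen v s') < v i (chosen v s) ->
  forall t, t <= s' -> avail v' t = avail v t /\ chosen v' t = chosen v t.
Proof.
move=> si lt lt' noi v'E lti; set r := chosen v s' in v'E lti.
suff av t : t <= s' -> avail v' t = avail v t -> chosen v' t = chosen v t.
  elim=> [_|t IH le]; first by split=> //; apply: av.
  have [eqa eqc] := IH (ltnW le).
  have eqS : avail v' t.+1 = avail v t.+1 by rewrite !availS eqa eqc.
  by split=> //; apply: av.
move=> le eqa; rewrite /chosen eqa; case: (eqVneq (inZp t) i) => [ti|nti].
  (* At a turn of [i] the item [r] is available but not picked, and its lowered value stays below
     the pick, since the picks of [i] only get worse up to step [s]. At the turns of the other
     agents nothing relevant has changed. *)
  have les : t <= s by rewrite leqNgt; apply/negP => lts; apply: (noi t); rewrite ?lts.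
  rewrite ti; have ltt : t < s' := leq_ltn_trans les lt.
  have bE : best (v i) (avail v t) = chosen v t by rewrite /chosen ti.
  rewrite bE; apply: etrans bE; apply: (@best_stable _ _ _ r); rewrite /chosen ?ti //.
  - by move=> a ne; rewrite v'E // xpair_eqE (negbTE ne) andbF.
  - exact: (chosen_avail_le v (ltnW ltt) lt').
  - by have := chosen_neq v ltt lt'; rewrite /chosen ti.
  - apply: leq_trans lti _; have := chosen_max v ti les (ltn_trans lt lt').
    by rewrite {2}/chosen ti.
by congr (odflt _ _); apply: eq_pick => a /=; congr (_ && _); apply: eq_forallb => b;
  rewrite /key !v'E // xpair_eqE (negbTE nti).
Qed.

End RoundRobin.

(** * Random profiles of cells *)

Lemma inZp_step (n t : nat) (i : 'I_n.+1) : inZp (t * n.+1 + i) = i.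
Proof. by apply: val_inj; rewrite /= modnMDl modn_small. Qed.

Lemma inZp_step_neq (n t e : nat) (i : 'I_n.+1) : (0 < e <= n)%N ->
  inZp (t * n.+1 + i + e) <> i.
Proof.
move=> /andP[e0 en] /(congr1 val) /=; rewrite -addnA modnMDl.
have := ltn_ord i; case: (ltnP (i + e) n.+1) => [lt|ge] ltin.
  by rewrite modn_small //; lia.
rewrite -(subnK ge) modnDr modn_small; lia.
Qed.

Section RandomProfile.
Context {R : realFieldType} {n m N : nat}.
Variable w : 'I_n.+1 * 'I_m.+1 -> 'I_N.+1 -> R.
Hypothesis w_ge0 : forall c z, 0 <= w c z.
Hypothesis sum_w : forall c, \sum_z w c z = 1.

Local Notation profile := {ffun 'I_n.+1 * 'I_m.+1 -> 'I_N.+1}.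
Implicit Types (k : profile) (i : 'I_n.+1) (t e h : nat).

Definition cells k (j : 'I_n.+1) (a : 'I_m.+1) : nat := k (j, a).

Definition top k i t : nat := cells k i (chosen (cells k) (t * n.+1 + i)).

(* [e] is the number of steps from a pick of [i] to the compared pick of another agent. *)
Definition later k i e t : nat := cells k i (chosen (cells k) (t * n.+1 + i + e)).

(** The gap is compared with [h] additively, which avoids truncated subtraction. *)
Definition small_gap h k i e t : bool := (top k i t < later k i e t + h)%N.

(** Induction on the number of rounds, each round in [T] costing a factor [r]. Lowering the compared
    item below the pick of [i] alters neither the earlier gaps nor that pick, by [chosen_stable], so
    [Pr_small_gap] applies. *)
Lemma Pr_small_gaps i e h (th : nat) (r : R) (T : pred nat) (K : nat) :
  (0 < e <= n)%N -> (0 < th)%N -> 0 <= r ->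
  (forall a (x : nat), (th <= x)%N ->
     \sum_(z : 'I_N.+1 | (z <= x < z + h)%N) w (i, a) z
       <= r * \sum_(z : 'I_N.+1 | (z < x)%N) w (i, a) z) ->
  (K.+1 * n.+1 <= m.+1)%N ->
  Pr w (fun k => all (fun t => T t ==> (th <= top k i t)%N && small_gap h k i e t)
                     (iota 0 K)) <= r ^+ (\sum_(0 <= t < K) T t).
Proof.
move=> he th0 r0 Hw; have /andP[e0 en] := he.
pose E K k := all (fun t => T t ==> (th <= top k i t)%N && small_gap h k i e t) (iota 0 K).
rewrite -/(E K); elim: K => [_|K IH leK].
  rewrite big_geq // expr0 -(Pr_all sum_w); exact: Pr_le.
have ES k : E K.+1 k = E K k && (T K ==> (th <= top k i K)%N && small_gap h k i e K).
  by rewrite /E -addn1 iotaD all_cat /= add0n andbT.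
have le_IH : Pr w (E K) <= r ^+ \sum_(0 <= t < K) T t by apply: IH; lia.
rewrite big_nat_recr //=; case TK: (T K); last first.
  rewrite addn0; apply: le_trans le_IH; apply: Pr_le => // k.
  by rewrite ES => /andP[].
(* The threshold of round [K] belongs to the conditioning event: it is decided before the compared
   item is picked. *)
rewrite addn1 exprS; set F := fun k => E K k && (th <= top k i K)%N.
apply: (@le_trans _ _ (r * Pr w F)); last first.
  apply: ler_wpM2l => //; apply: le_trans le_IH.
  by apply: Pr_le => // k /andP[].
set s := (K * n.+1 + i)%N.
(* The compared pick may fall in the following round, which is why the hypothesis reserves one extra
   round. *)
have lt_s : (s + e < m.+1)%N by have := ltn_ord i; rewrite /s; lia.
have le_se : (s <= s + e)%N by rewrite leq_addr.
pose crd k := (i, chosen (cells k) (s + e)).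
apply: (@le_trans _ _ (Pr w (fun k => F k && (top k i K < k (crd k) + h)%N))).
  by apply: Pr_le => // k; rewrite ES TK /F /= -andbA.
apply: Pr_small_gap => //.
- by move=> k /andP[_]; exact: leq_trans.
- by move=> k _; apply: (chosen_max (cells k)) => //; exact: inZp_step.
- move=> k z /andP[Ek thk] ltz k'.
  have off j a : (j, a) != (i, chosen (cells k) (s + e)) -> cells k' j a = cells k j a.
    by move=> ne; rewrite /cells /k' updNE.
  have noi s'' : (s < s'' <= s + e)%N -> inZp s'' <> i.
    move=> /andP[lt1 le1]; have -> : s'' = (K * n.+1 + i + (s'' - s))%N by lia.
    by apply: inZp_step_neq; lia.
  have lts : (s < s + e)%N by lia.
  have ltz' : (cells k' i (chosen (cells k) (s + e)) < cells k i (chosen (cells k) s))%N.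
    by rewrite /cells /k' updE.
  have st := chosen_stable (inZp_step K i) lts lt_s noi off ltz'.
  have same t : (t < s + e)%N ->
      cells k' i (chosen (cells k') t) = cells k i (chosen (cells k) t).
    move=> lt; have [_ ->] := st t (ltnW lt); apply: off.
    by rewrite xpair_eqE eqxx /= eq_sym chosen_neq.
  have topE t : (t <= K)%N -> top k' i t = top k i t.
    by move=> le; apply: same; rewrite /s; nia.
  split.
  + rewrite /F topE // thk andbT; apply/allP => t tK.
    move/allP: (Ek) => /(_ t tK); move: tK; rewrite mem_iota /= add0n => lt.
    rewrite /small_gap (topE t (ltnW lt)) /later same //.
    by rewrite /s; nia.
  + by rewrite /crd; have [_ ->] := st (s + e)%N (leqnn _).
  + by apply: same; exact: lts.
- by move=> k /andP[_ thk]; exact: Hw.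
Qed.

Definition low (th : nat) K k i : bool := [exists t : 'I_K, (top k i t < th)%N].

(** Union bound over the sets of at least [B] rounds: there are at most [4 ^ B] of them, and each
    contributes at most [r ^+ B]. *)
Lemma Pr_many_small_gaps i e h (th B : nat) (r : R) :
  (0 < e <= n)%N -> (0 < th)%N -> 0 <= r <= 1 ->
  (forall a (x : nat), (th <= x)%N ->
     \sum_(z : 'I_N.+1 | (z <= x < z + h)%N) w (i, a) z
       <= r * \sum_(z : 'I_N.+1 | (z < x)%N) w (i, a) z) ->
  (B.*2.+1 * n.+1 <= m.+1)%N ->
  Pr w (fun k => ~~ low th B.*2 k i &&
                 (B <= #|[set t : 'I_B.*2 | small_gap h k i e t]|)%N) <= (4 * r) ^+ B.
Proof.
move=> he th0 /andP[r0 r1] Hw leK.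
(* Extends [T] to all round numbers, with no constraint beyond the first [2B] rounds. *)
pose nT (T : {set 'I_B.*2}) (t : nat) := if insub t is Some s then s \in T else false.
pose F T k := all (fun t => nT T t ==> (th <= top k i t)%N && small_gap h k i e t)
                     (iota 0 B.*2).
apply: (@le_trans _ _ (\sum_(T : {set 'I_B.*2} | (B <= #|T|)%N) Pr w (F T))).
  apply: Pr_union => // k /andP[nlow many].
  exists [set t : 'I_B.*2 | small_gap h k i e t] => //.
  apply/allP => t _; apply/implyP; rewrite /nT; case: insubP => // s _ <-.
  rewrite inE => ->; rewrite andbT leqNgt; apply: contra nlow => lt.
  by apply/existsP; exists s.
apply: (@le_trans _ _ (\sum_(T : {set 'I_B.*2} | (B <= #|T|)%N) r ^+ B)).
  apply: ler_sum => T leT.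
  apply: le_trans (Pr_small_gaps (nT T) he th0 r0 Hw leK) _.
  apply: ler_wiXn2l => //; apply: leq_trans leT _.
  rewrite big_mkord -sum1_card big_mkcond /=; apply: leq_sum => s _.
  by rewrite /nT valK; case: (s \in T).
rewrite sumr_const exprMn -[leLHS]mulr_natl; apply: ler_wpM2r; first exact: exprn_ge0.
rewrite -natrX ler_nat.
apply: leq_trans (max_card _) _.
by rewrite -cardsT -powersetT card_powerset cardsT card_ord -mul2n expnM.
Qed.

(** A pick below [th] forces every remaining item below [th], and at least half of the items remain.
    Each such set has probability at most [16^-1] to the power [m.+1 / 2], that is [4^-1 ^+ m.+1],
    and there are at most [2 ^ m.+1] sets. *)
Lemma Pr_low i (th K : nat) :
  (forall a, \sum_(z : 'I_N.+1 | (z < th)%N) w (i, a) z <= 16^-1) ->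
  ((K * n.+1).*2 <= m.+1)%N ->
  Pr w (fun k => low th K k i) <= 2^-1 ^+ m.+1.
Proof.
move=> Hw leK.
pose A (S : {set 'I_m.+1}) : {set 'I_n.+1 * 'I_m.+1} := [set c | (c.1 == i) && (c.2 \in S)].
pose F S (k : profile) := [forall c in A S, (k c < th)%N].
apply: (@le_trans _ _ (\sum_(S : {set 'I_m.+1} | (m.+1 <= #|S|.*2)%N) Pr w (F S))).
  apply: Pr_union => // k /existsP[t lt].
  exists (avail (cells k) (t * n.+1 + i)).
    by rewrite card_avail; have := ltn_ord t; have := ltn_ord i; nia.
  apply/forall_inP => -[j a]; rewrite inE /= => /andP[/eqP -> aS].
  apply: leq_ltn_trans lt; rewrite /top /chosen inZp_step.
  exact: (best_max (cells k i)).
apply: (@le_trans _ _ (\sum_(S : {set 'I_m.+1} | (m.+1 <= #|S|.*2)%N) 4^-1 ^+ m.+1)).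
  apply: ler_sum => S leS; rewrite (Pr_rect sum_w (A S) (fun _ (z : 'I_N.+1) => (z < th)%N)).
  apply: (@le_trans _ _ (\prod_(c in A S) 16^-1)).
    apply: ler_prod => -[j a]; rewrite inE /= => /andP[/eqP -> _].
    by rewrite Hw andbT; apply: sumr_ge0.
  have cA : #|A S| = #|S|.
    rewrite -(card_imset (mem S) (f := pair i)); last by move=> a b [].
    apply: eq_card => -[j a]; rewrite inE /=; apply/andP/imsetP => [[/eqP -> aS]|[b bS [-> ->]]].
      by exists a.
    by rewrite eqxx.
  have -> : (16 : R)^-1 = 4^-1 ^+ 2 by rewrite exprVn -natrX.
  rewrite prodr_const cA -exprM mul2n.
  apply: ler_wiXn2l leS; first by rewrite invr_ge0.
  by rewrite invf_le1 ?ler1n.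
rewrite sumr_const -[leLHS]mulr_natl.
have -> : (4 : R)^-1 = 2^-1 * 2^-1 by rewrite -invfM -natrM.
rewrite exprMn mulrA ger_pMl ?exprn_gt0 ?invr_gt0 //.
rewrite exprVn ler_pdivrMr ?exprn_gt0 // mul1r -natrX ler_nat.
apply: leq_trans (max_card _) _.
by rewrite -cardsT -powersetT card_powerset cardsT card_ord.
Qed.

End RandomProfile.

(** * Envy-freeness of round robin *)

Lemma sum_residue (V : nmodType) (g : nat -> V) (n M : nat) (j : 'I_n.+1) :
  \sum_(0 <= s < M * n.+1 | inZp s == j) g s = \sum_(0 <= t < M) g (t * n.+1 + j)%N.
Proof.
elim: M => [|M IH]; first by rewrite mul0n !big_geq.
rewrite big_nat_recr //= -IH mulSnr.
rewrite (@big_cat_nat _ _ _ (M * n.+1)) ?leq_addr //=; congr (_ + _).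
rewrite -{1}[(M * n.+1)%N]add0n big_addn addKn big_mkord (big_pred1 j) => [|s /=].
  by rewrite addnC.
by rewrite addnC -{2}(inZp_step M s).
Qed.

Section Deterministic.
Context {R : realType} {n m N : nat}.
Variables (u : 'I_n.+1 -> 'I_m.+1 -> R)
  (k : {ffun 'I_n.+1 * 'I_m.+1 -> 'I_N.+1}).
Hypothesis N_gt0 : (0 < N)%N.
Hypothesis cell_le : forall i a, (k (i, a))%:R <= N%:R * u i a.
Hypothesis lt_cell : forall i a, N%:R * u i a <= (k (i, a)).+1%:R.

Local Notation pk := (chosen (cells k)).

(** The value 0 past the last item lets all agents be summed over the same range of rounds. *)
Definition step_utility i s : R := if (s < m.+1)%N then u i (pk s) else 0.

Lemma utility_ge0 i a : 0 <= u i a.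
Proof. by rewrite -(@pmulr_rge0 _ N%:R) ?ltr0n //; apply: le_trans (cell_le i a). Qed.

Lemma step_utility_ge0 i s : 0 <= step_utility i s.
Proof. by rewrite /step_utility; case: ifP => // _; exact: utility_ge0. Qed.

Definition rr_alloc : {ffun 'I_n.+1 -> {set 'I_m.+1}} :=
  [ffun j => [set pk (s : 'I_m.+1) | s in [pred s : 'I_m.+1 | inZp s == j]]].

Lemma rr_allocation : allocation rr_alloc.
Proof.
have injpk : injective (fun s : 'I_m.+1 => pk s) := @chosen_inj _ _ (cells k).
split=> [i j ne|].
  apply/setP => a; rewrite !inE !ffunE; apply/negbTE/negP.
  case/andP=> /imsetP[s]; rewrite inE => /eqP si -> /imsetP[s']; rewrite inE => /eqP sj.
  by move/injpk => ss'; move: ne; rewrite -si -sj ss' eqxx.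
apply/setP => a; rewrite inE; apply/bigcupP.
have [s sK Ks] : bijective (fun s : 'I_m.+1 => pk s) := injF_bij injpk.
by exists (inZp (s a)) => //; rewrite ffunE; apply/imsetP; exists (s a); rewrite ?inE ?Ks.
Qed.

Lemma rr_utility i j :
  bundle_utility u i (rr_alloc j) = \sum_(0 <= t < m.+1) step_utility i (t * n.+1 + j)%N.
Proof.
rewrite /bundle_utility ffunE big_imset /=; last first.
  by move=> s s' _ _; exact: (@chosen_inj _ _ (cells k)).
rewrite -sum_residue (@big_cat_nat _ _ _ m.+1) ?leq_pmulr //=.
rewrite [X in _ = _ + X]big_nat_cond [X in _ = _ + X]big1 ?addr0; last first.
  by move=> s /andP[/andP[le _] _]; rewrite /step_utility ltnNge le.
by rewrite big_mkord; apply: eq_big => // s _; rewrite /step_utility ltn_ord.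
Qed.

(** If [j] moves after [i] in a round, then [e = j - i]. Otherwise the next pick of [j] is in the
    following round and the first pick of [j] is left unmatched; it is worth at most [N.+1] in units
    of [1/N]. *)
Lemma rr_shift i j : i != j -> exists2 e : nat, (0 < e <= n)%N &
  N%:R * bundle_utility u i (rr_alloc j) <=
    N.+1%:R + N%:R * \sum_(0 <= t < m.+1) step_utility i (t * n.+1 + i + e)%N.
Proof.
move=> ne; rewrite rr_utility; have ltin := ltn_ord i; have ltjn := ltn_ord j.
have gbd s : N%:R * step_utility i s <= N.+1%:R.
  rewrite /step_utility; case: ifP => _; last by rewrite mulr0.
  by apply: le_trans (lt_cell _ _) _; rewrite ler_nat.
case: (ltngtP i j) => [lt|lt|eq_ij]; last by move: ne; rewrite (val_inj eq_ij) eqxx.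
  exists (j - i)%N; first by lia.
  rewrite ler_wpDl //; under [X in _ <= _ * X]eq_bigr => t _.
    by rewrite -addnA subnKC ?(ltnW lt) //; over.
  by [].
exists (n.+1 + j - i)%N; first by lia.
(* One more nonnegative term is added at the end, so that splitting off the first pick leaves
   exactly [m.+1] terms. *)
apply: (@le_trans _ _ (N%:R * \sum_(0 <= t < m.+2) step_utility i (t * n.+1 + j)%N)).
  apply: ler_wpM2l => //; rewrite [leRHS]big_nat_recr //= lerDl; exact: step_utility_ge0.
rewrite big_nat_recl // mulrDr lerD //; apply: ler_wpM2l => //.
by rewrite le_eqVlt; apply/orP; left; apply/eqP; apply: eq_bigr => t _; congr (step_utility i _); lia.
Qed.

(** Term by term, the pick of [i] is at least as good in cells as the compared one, and better by
    [h] when the gap is not small. Rounding costs at most 1 per term, hence [m.+1] in total. *)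
Lemma rr_gain i e (h K B : nat) : (0 < e <= n)%N -> (K.+1 * n.+1 <= m.+1)%N ->
  (B <= #|[set t : 'I_K | ~~ small_gap h k i e t]|)%N ->
  (B * h)%:R - m.+1%:R + N%:R * \sum_(0 <= t < m.+1) step_utility i (t * n.+1 + i + e)%N <=
    N%:R * bundle_utility u i (rr_alloc i).
Proof.
move=> he leK leB; rewrite rr_utility -lerBrDr -mulrBr -sumrB mulr_sumr.
have ltin := ltn_ord i.
pose big t := (t < K)%N && ~~ small_gap h k i e t.
apply: (@le_trans _ _ (\sum_(0 <= t < m.+1) ((big t * h)%N%:R - 1))).
  rewrite sumrB -natr_sum -big_distrl /= sumr_const_nat subn0 lerB // ler_nat.
  rewrite leq_mul2r; apply/orP; right; apply: leq_trans leB _.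
  rewrite (@big_cat_nat _ _ _ K) //=; last by nia.
  apply: leq_trans (leq_addr _ _); rewrite big_mkord -sum1_card big_mkcond /=.
  by apply: leq_sum => t _; rewrite inE /big ltn_ord; case: (~~ _).
apply: ler_sum => t _; set s := (t * n.+1 + i)%N.
case: (ltnP (s + e) m.+1) => [lt|ge]; last first.
  have -> : big t = false.
    by apply/negbTE; rewrite /big negb_and -leqNgt; apply/orP; left; rewrite /s in ge; nia.
  rewrite mul0n /step_utility [(s + e < _)%N]ltnNge ge /= subr0.
  by apply: (@le_trans _ _ 0); [rewrite sub0r lerN10|rewrite mulr_ge0 //; exact: step_utility_ge0].
have lt' : (s < m.+1)%N by lia.
rewrite /step_utility lt lt' mulrBr.
have le1 := cell_le i (pk s); have le2 := lt_cell i (pk (s + e)).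
have le3 : (cells k i (pk (s + e)) <= cells k i (pk s))%N.
  by apply: chosen_max; rewrite ?leq_addr // inZp_step.
have : (big t * h + cells k i (pk (s + e)) <= cells k i (pk s))%N.
  case bt: (big t); last by rewrite mul0n.
  by move: bt => /andP[_]; rewrite /small_gap /top /later -leqNgt mul1n addnC.
rewrite /cells -(ler_nat R) natrD; move: le2; rewrite -addn1 natrD.
set x := N%:R * _; set y := N%:R * _; move: le1; rewrite -/y; lra.
Qed.

(** The gain [B * h] has to cover [N.+1] for the unmatched first pick and [m.+1] for the rounding
    errors. *)
Lemma round_robin_envy_free (h K B : nat) :
  (K.+1 * n.+1 <= m.+1)%N -> (N.+1 + m.+1 <= B * h)%N ->
  (forall i e, (0 < e <= n)%N -> (B <= #|[set t : 'I_K | ~~ small_gap h k i e t]|)%N) ->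
  envy_free_allocation_exists u.
Proof.
move=> leK leBh many; exists rr_alloc; split; first exact: rr_allocation.
move=> i j; have [->//|ne] := eqVneq i j.
have [e he le1] := rr_shift ne.
have le2 := rr_gain he leK (many i e he).
rewrite -(@ler_pM2l _ N%:R) ?ltr0n //; apply: (le_trans le1); apply: le_trans le2.
rewrite lerD2r; move: leBh; rewrite -(ler_nat R) natrD; lra.
Qed.

End Deterministic.

(** * Quantile thresholds and the union bound over agents *)

Lemma sum_window (R : realFieldType) (N h x : nat) (W : 'I_N.+1 -> R) (dl : R) :
  (forall z, W z <= dl) -> 0 <= dl ->
  \sum_(z : 'I_N.+1 | (z <= x < z + h)%N) W z <= h%:R * dl.
Proof.
move=> Wd d0; apply: (@le_trans _ _ (\sum_(z : 'I_N.+1 | (z <= x < z + h)%N) dl)).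
  by apply: ler_sum => z _; exact: Wd.
rewrite sumr_const -[leLHS]mulr_natl ler_wpM2r // ler_nat.
(* The window sits in a run of [h] integers; truncated subtraction starts that run at 0 when [h]
   exceeds [x.+1]. *)
rewrite -[leqRHS](size_iota (x.+1 - h) h) cardE -(size_map val).
apply: uniq_leq_size; first by rewrite (map_inj_uniq val_inj) enum_uniq.
move=> z /mapP[z']; rewrite mem_enum unfold_in => /andP[le lt] ->.
rewrite mem_iota /=; apply/andP; split; lia.
Qed.

(** Take the least [th] with mass at least [32^-1] below it: its last cell adds at most [32^-1], so
    the mass stays within [16^-1]. The upper bound serves [Pr_low]; the lower bound is the
    denominator of the conditional probability of a small gap. *)
Lemma quantile_cell (R : realFieldType) (N : nat) (W : 'I_N.+1 -> R) :
  (forall z, 0 <= W z) -> \sum_z W z = 1 -> (forall z, W z <= 32^-1) ->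
  exists th : nat, [/\ (0 < th)%N, \sum_(z : 'I_N.+1 | (z < th)%N) W z <= 16^-1 &
    forall x, (th <= x)%N -> 32^-1 <= \sum_(z : 'I_N.+1 | (z < x)%N) W z].
Proof.
move=> W0 W1 Wd; pose cum x := \sum_(z : 'I_N.+1 | (z < x)%N) W z.
have exth : exists x, 32^-1 <= cum x.
  exists N.+1; rewrite /cum (eq_bigl xpredT) => [|z]; last exact: ltn_ord.
  by rewrite W1 invf_le1 ?ler1n.
case: (ex_minnP exth) => th cth minth.
have th0 : (0 < th)%N.
  rewrite lt0n; apply/eqP => th0; move: cth; rewrite th0 /cum big_pred0 //.
  by rewrite leNgt invr_gt0 ltr0n.
exists th; split=> // [|x le]; last first.
  apply: le_trans cth _; rewrite /cum big_mkcond [leRHS]big_mkcond /=.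
  apply: ler_sum => z _; case: ltnP => [lt|_]; last by case: ifP.
  by rewrite (leq_trans lt le).
have lt1 : cum th.-1 < 32^-1.
  by rewrite ltNge; apply/negP => /minth; lia.
have -> : \sum_(z : 'I_N.+1 | (z < th)%N) W z =
          cum th.-1 + \sum_(z : 'I_N.+1 | z == th.-1 :> nat) W z.
  rewrite (bigID (fun z : 'I_N.+1 => (z < th.-1)%N)) /=; congr (_ + _); apply: eq_bigl => z.
    by rewrite andb_idl // => ?; lia.
  by rewrite -leqNgt; apply/andP/eqP => [[]|]; lia.
have le2 : \sum_(z : 'I_N.+1 | z == th.-1 :> nat) W z <= 32^-1.
  case: (ltnP th.-1 N.+1) => [lt|ge].
    by rewrite (big_pred1 (Ordinal lt)) // => z /=; rewrite -val_eqE.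
  rewrite big_pred0 ?invr_ge0 // => z; apply/negbTE/eqP => eq; have := ltn_ord z; lia.
have -> : 16^-1 = 32^-1 + 32^-1 :> R by field.
by apply: lerD => //; exact: ltW.
Qed.

Lemma succ_double_le (B : nat) : (0 < B -> B.*2.+1 <= 4 * B)%N.
Proof. lia. Qed.

Definition good (n m N : nat) (h B : nat) (k : {ffun 'I_n.+1 * 'I_m.+1 -> 'I_N.+1}) :=
  [forall i, forall e : 'I_n.+1,
     (0 < e)%N ==> (B <= #|[set t : 'I_B.*2 | ~~ small_gap h k i e t]|)%N].

(** A window of [h] cells has mass at most [h * dl], against at least [32^-1] below the pick, so a
    small gap has conditional probability at most [r = 32 * h * dl]. The two error terms are many
    small gaps, for each agent and offset, and a low pick, for each agent. *)
Lemma Pr_bad (R : realFieldType) (n m N h B : nat) (W : 'I_n.+1 -> 'I_N.+1 -> R) (dl : R) :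
  (forall i z, 0 <= W i z) -> (forall i, \sum_z W i z = 1) ->
  (forall i z, W i z <= dl) -> 0 <= dl -> dl <= 32^-1 -> 32 * (h%:R * dl) <= 1 ->
  (0 < B)%N -> (4 * B * n.+1 <= m.+1)%N ->
  1 - (n.+1%:R ^+ 2 * (128 * (h%:R * dl)) ^+ B + n.+1%:R * 2^-1 ^+ m.+1) <=
  Pr (fun c : 'I_n.+1 * 'I_m.+1 => W c.1) (good h B).
Proof.
move=> W0 W1 Wd d0 d32 r1 B0 leB; set r := 32 * _ in r1.
have -> : 128 * (h%:R * dl) = 4 * r by rewrite /r; ring.
have r0 : 0 <= r by rewrite /r !mulr_ge0.
set w := fun c => _; have w0 c z : 0 <= w c z by exact: W0.
have w1 c : \sum_z w c z = 1 by exact: W1.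
have W32 i z : W i z <= 32^-1 by exact: le_trans (Wd i z) d32.
pose th i := sval (cid (quantile_cell (W0 i) (W1 i) (W32 i))).
have thP i := svalP (cid (quantile_cell (W0 i) (W1 i) (W32 i))).
rewrite (Pr_compl w1) lerD2l lerN2.
pose F (j : ('I_n.+1 * 'I_n.+1) + 'I_n.+1) (k : {ffun 'I_n.+1 * 'I_m.+1 -> 'I_N.+1}) :=
  match j with
  | inl (i, e) => ~~ low (th i) B.*2 k i && (B <= #|[set t : 'I_B.*2 | small_gap h k i e t]|)%N
  | inr i => low (th i) B.*2 k i
  end.
pose Q (j : ('I_n.+1 * 'I_n.+1) + 'I_n.+1) := if j is inl (i, e) then (0 < e)%N else true.
apply: (@le_trans _ _ (\sum_(j | Q j) Pr w (F j))).
  apply: Pr_union => // k /=; rewrite negb_forall => /existsP[i].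
  rewrite negb_forall => /existsP[e]; rewrite negb_imply -ltnNge => /andP[e0 few].
  have [lowi|nlow] := boolP (low (th i) B.*2 k i); first by exists (inr i).
  exists (inl (i, e)) => //=; rewrite nlow /=.
  have := cardsC [set t : 'I_B.*2 | small_gap h k i e t]; rewrite card_ord.
  rewrite (_ : ~: _ = [set t : 'I_B.*2 | ~~ small_gap h k i e t]); last first.
    by apply/setP => t; rewrite !inE.
  move=> eqc; rewrite leqNgt; apply/negP => lt.
  by have := leq_add lt few; rewrite addSn addnS addnn -[leqRHS]eqc; move/ltnW; rewrite ltnn.
rewrite big_sumType /=; apply: lerD.
  apply: (@le_trans _ _ (\sum_(ie : 'I_n.+1 * 'I_n.+1 | Q (inl ie)) (4 * r) ^+ B)).
    apply: ler_sum => -[i e] /= e0; have [th0 _ thx] := thP i.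
    apply: Pr_many_small_gaps => //; rewrite ?r0 ?r1 ?e0 ?(leq_ord e) //; last first.
      by apply: leq_trans leB; rewrite leq_mul2r succ_double_le.
    move=> a x /thx le; apply: le_trans (sum_window h x (Wd i) d0) _.
    by apply: le_trans (ler_wpM2l r0 le); rewrite /r mulrAC divff ?mul1r ?pnatr_eq0.
  rewrite sumr_const -[leLHS]mulr_natl; apply: ler_wpM2r; first by rewrite exprn_ge0 // mulr_ge0.
  by rewrite -natrX ler_nat (leq_trans (max_card _)) // card_prod !card_ord mulnn.
apply: (@le_trans _ _ (\sum_(i : 'I_n.+1) 2^-1 ^+ m.+1)); last first.
  by rewrite sumr_const card_ord mulr_natl.
apply: ler_sum => i _; have [_ thle _] := thP i.
by apply: Pr_low => //; lia.
Qed.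

(** * Discretization of the utilities *)

Local Open Scope classical_set_scope.
Local Open Scope ring_scope.

Lemma mass_support_compl_null (R : realType) (D : probability R R) :
  measurable (mass_support D) -> D (~` mass_support D) = 0%E.
Proof.
move=> mS; apply/(negligibleP D); first exact: measurableC.
(* Lindelof: the complement is covered by the null intervals with rational endpoints. *)
pose I (r : rat * rat) : set R := `]ratr r.1, ratr r.2[%classic.
pose F (j : nat) : set R :=
  if unpickle j is Some r then (if D (I r) == 0%E then I r else set0) else set0.
apply: (@negligibleS _ _ _ D (\bigcup_j F j)); last first.
  apply: negligible_bigcup => j; rewrite /F.
  case: (unpickle j) => [r|]; last exact: negligible_set0.
  case: eqP => [D0|_]; last exact: negligible_set0.
  by apply/negligibleP => //; exact: measurable_itv.
move=> x nSx; have [V [oV Vx DV]] : exists V : set R, [/\ open V, V x & D V = 0%E].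
  apply: contrapT => nV; apply: nSx => V oV Vx; rewrite lt0e measure_ge0 andbT.
  by apply/eqP => D0; apply: nV; exists V.
have /nbhs_ballP[e /= e0 eV] : nbhs x V by exact: open_nbhs_nbhs.
have [r1 /[!in_itv] /= /andP[r1l r1r]] : exists r1 : rat, ratr r1 \in `]x - e, x[.
  by apply: rat_in_itvoo; rewrite ltrBlDr ltrDl.
have [r2 /[!in_itv] /= /andP[r2l r2r]] : exists r2 : rat, ratr r2 \in `]x, x + e[.
  by apply: rat_in_itvoo; rewrite ltrDl.
have Ix : I (r1, r2) x by rewrite /I /= in_itv /= r1r r2l.
suff D0 : D (I (r1, r2)) = 0%E.
  by exists (pickle (r1, r2)); [|rewrite /F pickleK D0 eqxx].
apply/eqP; rewrite -measure_le0 -DV; apply: le_measure; rewrite ?inE.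
- exact: measurable_itv.
- exact: open_measurable.
- move=> y; rewrite /I /= in_itv /= => /andP[y1 y2]; apply: eV.
  by rewrite /ball /= ltr_distlC (lt_trans r1l y1) (lt_trans y2 r2r).
Qed.

(** The density is controlled only on the support, so the interval is first cut down to it; the part
    outside is null by [mass_support_compl_null]. *)
Lemma pdf_bounded_itv (R : realType) (p q : R) (D : probability R R) (y l : R) :
  interval_support D -> pdf_bounded p q D -> 0 <= l -> 0 <= q ->
  (D `[y, (y + l)%R[%classic <= (q * l)%R%:E)%E.
Proof.
move=> [a [b [_ _ _ suppE]]] [f [[mf f0 fE] fpq]] l0 q0.
have mS : measurable (mass_support D) by rewrite suppE; exact: measurable_itv.
have mI : measurable (`[y, (y + l)%R[%classic : set R) by exact: measurable_itv.
have D0 : D (`[y, (y + l)%R[%classic `\` mass_support D) = 0%E.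
  apply/eqP; rewrite -measure_le0 -(mass_support_compl_null mS).
  by apply: le_measure; rewrite ?inE; [exact: measurableD|exact: measurableC|move=> x []].
have -> : D `[y, (y + l)%R[%classic = D (`[y, (y + l)%R[%classic `&` mass_support D).
  by rewrite {1}(measureDI D mI mS) [X in (X + _)%E]D0 add0e.
rewrite fE; last exact: measurableI.
apply: (@le_trans _ _ (\int[@lebesgue_measure R]_(x in `[y, (y + l)%R[%classic `&` mass_support D) q%:E)%E).
  apply: ge0_le_integral => //.
  - exact: measurableI.
  - by move=> x _; rewrite lee_fin.
  - by apply/measurable_EFinP; exact: measurable_funTS.
  - by move=> x [_ /fpq /andP[_]]; rewrite lee_fin.
rewrite integral_cst; last exact: measurableI.
rewrite EFinM; apply: lee_wpmul2l; first by rewrite lee_fin.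
apply: (@le_trans _ _ (@lebesgue_measure R `[y, (y + l)%R[%classic)).
  by apply: le_measure; rewrite ?inE //; exact: measurableI.
rewrite lebesgue_measure_itv /= lte_fin.
case: ifP => _; last by rewrite lee_fin.
by rewrite -EFinD lee_fin; lra.
Qed.

Section Cells.
Context {R : realType} {N : nat}.
Hypothesis N_gt0 : (0 < N)%N.

Implicit Types D : probability R R.

(** Half-open, so that cells are disjoint. The value 1 falls in cell [N], hence [N.+1] cells for the
    unit interval. *)
Definition cell (z : nat) : set R := `[z%:R / N%:R, z%:R / N%:R + N%:R^-1[%classic.

Lemma measurable_cell z : measurable (cell z).
Proof. exact: measurable_itv. Qed.

Lemma cellP z (x : R) : cell z x <-> z%:R <= N%:R * x < z.+1%:R.
Proof.
have N0 : 0 < N%:R :> R by rewrite ltr0n.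
rewrite /cell /= in_itv /= ler_pdivrMr // [x * _]mulrC.
by rewrite -[X in _ + X]mul1r -mulrDl ltr_pdivlMr // [x * _]mulrC natr1.
Qed.

Lemma cell_disj z z' (x : R) : cell z x -> cell z' x -> z = z'.
Proof.
move=> /cellP/andP[l1 u1] /cellP/andP[l2 u2].
have := le_lt_trans l1 u2; have := le_lt_trans l2 u1; rewrite !ltr_nat; lia.
Qed.

Lemma cell_cover (x : R) : 0 <= x <= 1 -> exists z : 'I_N.+1, cell z x.
Proof.
move=> /andP[x0 x1]; have /truncn_itv/andP[l u] : 0 <= N%:R * x by rewrite mulr_ge0.
have lt : (Num.truncn (N%:R * x) < N.+1)%N.
  by rewrite ltnS -(ler_nat R); apply: (le_trans l); rewrite ler_piMr.
by exists (Ordinal lt); apply/cellP; rewrite l u.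
Qed.

Definition cell_weight (D : probability R R) (z : 'I_N.+1) : R := fine (D (cell z)).

Lemma cell_weight_ge0 D z : 0 <= cell_weight D z.
Proof. exact: fine_ge0. Qed.

Lemma cell_weightE D z : (cell_weight D z)%:E = D (cell z).
Proof. by rewrite fineK; [|apply: fin_num_measure; exact: measurable_cell]. Qed.

Lemma sum_cell_weight D : D `[0, 1]%classic = 1%E -> \sum_z cell_weight D z = 1.
Proof.
move=> D1; apply: EFin_inj; rewrite -sumEFin.
under eq_bigr do rewrite cell_weightE.
rewrite -(@measure_semi_additive_ord _ _ _ D _ (fun z : 'I_N.+1 => cell z)).
- apply/eqP; rewrite eq_le probability_le1 /=; last first.
    by apply: bigsetU_measurable => z _; exact: measurable_cell.
  rewrite -[leLHS]D1; apply: le_measure; rewrite ?inE.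
  + exact: measurable_itv.
  + by apply: bigsetU_measurable => z _; exact: measurable_cell.
  + move=> x /=; rewrite in_itv /= => /cell_cover[z xz].
    by rewrite -bigcup_mkord_ord; exists z => //=; rewrite inordK.
- by move=> z; exact: measurable_cell.
- by move=> z z' _ _ [x [xz xz']]; apply: val_inj; exact: cell_disj xz xz'.
- by apply: bigsetU_measurable => z _; exact: measurable_cell.
Qed.

End Cells.

Section Instance.
Context {d : measure_display} {T : measurableType d} {R : realType} {n m N : nat}.
Variables (P : probability T R) (D : 'I_n.+1 -> probability R R)
  (U : 'I_n.+1 -> 'I_m.+1 -> {RV P >-> R}).
Hypothesis N_gt0 : (0 < N)%N.
Hypothesis lawU : forall i a (B : set R),
  measurable B -> distribution P (U i a) B = D i B.
Hypothesis indU :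
  mutually_independent (fun ia : 'I_n.+1 * 'I_m.+1 => U ia.1 ia.2).

Local Notation profile := {ffun 'I_n.+1 * 'I_m.+1 -> 'I_N.+1}.

Definition rect (k : profile) : set T :=
  [set w | forall i a, @cell R N (k (i, a)) (U i a w)].

Lemma rectE (k : profile) : rect k =
  \bigcap_(c in [set` [set: 'I_n.+1 * 'I_m.+1]%SET]) (U c.1 c.2 @^-1` @cell R N (k c)).
Proof.
apply/seteqP; split => w.
  by move=> kw [i a] _; exact: kw.
by move=> kw i a; apply: (kw (i, a)); rewrite /= inE.
Qed.

Lemma measurable_rect k : measurable (rect k).
Proof.
rewrite rectE; apply: fin_bigcap_measurable => [|c _]; first exact: finite_finset.
by rewrite -[X in measurable X]setTI; apply: measurable_funPT => //; exact: measurable_cell.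
Qed.

Lemma P_rect (k : profile) :
  P (rect k) = (weight (fun c : 'I_n.+1 * 'I_m.+1 => cell_weight (D c.1)) k)%:E.
Proof.
rewrite rectE indU => [|c _]; last exact: measurable_cell.
rewrite /weight -prodEFin; apply: eq_big => [c|c _]; first by rewrite inE.
by rewrite cell_weightE -(lawU c.1 c.2) //; exact: measurable_cell.
Qed.

Lemma rect_disj (k k' : profile) w : rect k w -> rect k' w -> k = k'.
Proof.
move=> kw kw'; apply/ffunP => -[i a]; apply: val_inj.
exact: (cell_disj N_gt0 (kw i a) (kw' i a)).
Qed.

(** Transfers bounds from the finite product space to [P]: the events [rect k] are disjoint and
    their probabilities are the weights. *)
Lemma Pr_le_P (G : pred profile) (E : set T) : measurable E ->
  (forall k, G k -> rect k `<=` E) ->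
  ((Pr (fun c : 'I_n.+1 * 'I_m.+1 => cell_weight (D c.1)) G)%:E <= P E)%E.
Proof.
move=> mE GE; rewrite /Pr -sumEFin; under eq_bigr do rewrite -P_rect.
rewrite bigfs ?index_enum_uniq //; last by move=> i _; rewrite mem_index_enum.
rewrite -measure_fin_bigcup.
- apply: le_measure; rewrite ?inE //; last by move=> w [k /= Gk]; exact: GE.
  by apply: fin_bigcup_measurable => // k _; exact: measurable_rect.
- by [].
- by move=> k k' _ _ [w [kw kw']]; exact: rect_disj kw kw'.
- by move=> k _; exact: measurable_rect.
Qed.

End Instance.

Lemma one_instance (d : measure_display) (T : measurableType d) (R : realType)
    (n m B : nat) (q : R) (P : probability T R) (D : 'I_n -> probability R R)
    (U : 'I_n -> 'I_m -> {RV P >-> R}) :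
  (0 < n)%N -> (0 < B)%N -> (4 * B * n <= m)%N -> 0 <= q -> 64 * q <= B%:R ->
  (forall i, D i `[0, 1]%classic = 1%E) ->
  (forall i y l, 0 <= l -> (D i `[y, (y + l)%R[%classic <= (q * l)%R%:E)%E) ->
  (forall i a (B : set R), measurable B -> distribution P (U i a) B = D i B) ->
  mutually_independent (fun ia : 'I_n * 'I_m => U ia.1 ia.2) ->
  ((1 - (n%:R ^+ 2 * (256 * q / B%:R) ^+ B + n%:R * 2^-1 ^+ m))%:E
     <= P (envy_free_event U))%E.
Proof.
case: n D U => // n D U _ B0 leB q0 qB D01 Dq lawU indU.
case: m U leB lawU indU => [U|m U leB lawU indU]; first by rewrite leqn0 !muln_eq0; lia.
(* With [h = 2 * M], a gap of [h] cells is [2/B] and [B * h = 2 * N]. The summand [m.+2] makes [N]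
   absorb the rounding errors, and the other one gives [q / N <= 32^-1]. *)
pose M := (m.+2 + (Num.truncn (32 * q)).+1)%N; pose N := (M * B)%N.
have M0 : (0 < M)%N by [].
have N0 : (0 < N)%N by rewrite muln_gt0 M0.
have N0R : 0 < N%:R :> R by rewrite ltr0n.
have B0R : 0 < B%:R :> R by rewrite ltr0n.
have M0R : 0 < M%:R :> R by rewrite ltr0n.
have MN : (M <= N)%N by rewrite leq_pmulr.
have hd : (2 * M)%N%:R * (q / N%:R) = 2 * q / B%:R.
  rewrite /N !natrM; field; rewrite !gt_eqF //.
pose W i := @cell_weight R N (D i).
have W0 i z : 0 <= W i z by exact: cell_weight_ge0.
have W1 i : \sum_z W i z = 1 by apply: sum_cell_weight.
have Wq i z : W i z <= q / N%:R.
  by rewrite -lee_fin /W cell_weightE; apply: Dq; rewrite invr_ge0.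
have q32 : q / N%:R <= 32^-1.
  rewrite ler_pdivrMr // mulrC ler_pdivlMr // mulrC.
  have /truncn_itv/andP[_ /ltW le] : 0 <= 32 * q by rewrite mulr_ge0.
  by apply: (le_trans le); rewrite ler_nat (leq_trans _ MN) // /M; lia.
have d0 : 0 <= q / N%:R by rewrite divr_ge0.
have r1 : 32 * ((2 * M)%N%:R * (q / N%:R)) <= 1.
  by rewrite hd !mulrA ler_pdivrMr // mul1r; lra.
have := Pr_bad W0 W1 Wq d0 q32 r1 B0 leB.
rewrite hd (_ : 128 * (2 * q / B%:R) = 256 * q / B%:R); last by ring.
rewrite -lee_fin => le; apply: (le_trans le).
apply: (Pr_le_P N0 lawU indU); first exact: measurable_envy_free_event.
move=> k gk w kw; apply: (@round_robin_envy_free _ _ _ _ _ k N0 _ _ (2 * M) B.*2 B).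
- by move=> i a; have /(cellP N0)/andP[] := kw i a.
- by move=> i a; have /(cellP N0)/andP[_ /ltW] := kw i a.
- by apply: leq_trans leB; rewrite leq_mul2r succ_double_le.
- rewrite mulnCA [(B * M)%N]mulnC mul2n -addnn addSnnS leq_add2l.
  by apply: leq_trans MN; exact: leq_addr.
- move=> i e /andP[e0 en]; move/forallP: gk => /(_ i)/forallP/(_ (inord e)).
  by rewrite inordK // e0.
Qed.

(** * Asymptotics *)

(** Used with [y = ln (ln n)] and [a = 256 * q]. Taking [B] between [x] and [2 * x] for
    [x = 6 * expR y / y] gives [a / B <= expR (- (y / 2))], and [x * (y / 2) = 3 * expR y] yields
    the power [n ^ -3]. *)
Lemma rounds_count (R : realType) (a y : R) :
  0 <= a -> 1 <= y -> 3 * a <= y ->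
  exists B : nat, [/\ (0 < B)%N, a <= B%:R, B%:R <= 12 * expR y / y &
    expR (expR y) ^+ 3 * (a / B%:R) ^+ B <= 1].
Proof.
move=> a0 y1 ay; have y0 : 0 < y by lra.
pose x := 6 * expR y / y.
have x1 : 1 <= x.
  by rewrite /x ler_pdivlMr // mul1r; have := expR_ge1Dx y; lra.
have ax : a * expR (y / 2) <= x.
  have e2 : expR y = expR (y / 2) * expR (y / 2) by rewrite -expRD; congr expR; lra.
  have e4 : expR (y / 2) = expR (y / 4) * expR (y / 4) by rewrite -expRD; congr expR; lra.
  rewrite /x e2 mulrA [X in _ <= X]mulrAC ler_wpM2r ?expR_ge0 // ler_pdivlMr //.
  have y4 : 1 + y / 4 <= expR (y / 4) := expR_ge1Dx (y / 4).
  (* The claim amounts to [a * y <= 6 * expR (y / 2)]; since [a <= y / 3], a quadratic lower bound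
     on the exponential is enough. *)
  have sq : y ^+ 2 / 16 <= expR (y / 2).
    rewrite e4 (_ : y ^+ 2 / 16 = y / 4 * (y / 4)); last by field.
    by apply: ler_pM; lra.
  have ayy : a * y <= y / 3 * y by apply: ler_wpM2r; lra.
  have := expR_ge0 (y / 2); nra.
have twox : 2 * x = 12 * expR y / y by rewrite /x; lra.
have /truncn_itv/andP[Bl Bu] : 0 <= 2 * x by lra.
set B := Num.truncn (2 * x) in Bl Bu.
have xB : x <= B%:R by move: Bu; rewrite -natr1; lra.
have B0 : 0 < B%:R :> R by lra.
have e1 : 1 <= expR (y / 2) by have := expR_ge1Dx (y / 2); lra.
exists B; split.
- by rewrite -(ltr_nat R).
- by apply: le_trans (le_trans ax xB); rewrite ler_peMr.
- by rewrite -twox.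
have aB : a / B%:R <= expR (- (y / 2)).
  by rewrite expRN ler_pdivrMr // mulrC ler_pdivlMr ?expR_gt0 //; apply: le_trans ax xB.
have one : expR (expR y) ^+ 3 * expR (- (3%:R * expR y)) = 1 :> R.
  by rewrite -expRM_natl -expRD subrr expR0.
rewrite -[leRHS]one.
rewrite ler_wpM2l ?exprn_ge0 ?expR_ge0 //.
apply: (@le_trans _ _ (expR (- (y / 2)) ^+ B)).
  rewrite lerXn2r ?nnegrE ?expR_ge0 //.
  by apply: divr_ge0 => //; exact: ltW.
rewrite -expRM_natl ler_expR mulrN lerN2.
apply: (@le_trans _ _ (x * (y / 2))); last by apply: ler_wpM2r; lra.
rewrite le_eqVlt; apply/orP; left; apply/eqP; rewrite /x.
by field; rewrite gt_eqF.
Qed.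

(** Both terms are at most [1/n], the second because [n ^ 2 <= 2 ^ (2 * n) <= 2 ^ m]. As
    [harmonic n] is [1 / (n + 1)], the factor 4 absorbs the shift. *)
Lemma error_bound (R : realType) (n m : nat) (e : R) :
  (0 < n)%N -> (4 * n <= m)%N -> n%:R ^+ 3 * e <= 1 ->
  n%:R ^+ 2 * e + n%:R * 2^-1 ^+ m <= 4 * harmonic n.
Proof.
move=> n0 le4 le1; have n0R : 0 < n%:R :> R by rewrite ltr0n.
have A : n%:R ^+ 2 * e <= n%:R^-1.
  by rewrite -[leRHS]mul1r ler_pdivlMr // mulrAC -exprSr.
have B : n%:R * 2^-1 ^+ m <= n%:R^-1 :> R.
  rewrite exprVn ler_pdivrMr ?exprn_gt0 // mulrC ler_pdivlMr // -expr2 -!natrX ler_nat.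
  apply: leq_trans (_ : 2 ^ (n * 2) <= _)%N; last by rewrite leq_exp2l //; lia.
  by rewrite expnM leq_exp2r // ltnW // ltn_expl.
apply: (le_trans (lerD A B)); rewrite /harmonic /=.
have n1 : n.+1%:R = n%:R + 1 :> R by rewrite natr1.
have le1n : 1 <= n%:R :> R by rewrite ler1n.
rewrite -mulr2n -[leLHS]mulr_natl n1 ler_pdivlMr; last by lra.
by rewrite mulrAC ler_pdivrMr //; lra.
Qed.

Theorem proposition2 (R : realType) (p q : R) (p_gt0 : 0 < p) (lt_pq : p < q) :
  exists c : R, 0 < c /\
    forall (m : nat -> nat)
           (d : nat -> measure_display)
           (T : forall n : nat, measurableType (d n))
           (P : forall n : nat, probability (T n) R)
           (D : forall n : nat, 'I_n -> probability R R)
           (U : forall n : nat, 'I_n -> 'I_(m n) -> {RV (P n) >-> R}),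
      (\forall n \near \oo,
          c * (n%:R * ln n%:R / ln (ln n%:R)) <= (m n)%:R) ->
      (forall (n : nat) (i : 'I_n),
          [/\ utility_distribution (D n i), interval_support (D n i)
            & pdf_bounded p q (D n i)]) ->
      (forall (n : nat) (i : 'I_n) (a : 'I_(m n)) (B : set R),
          measurable B -> distribution (P n) (U n i a) B = D n i B) ->
      (forall n : nat,
          mutually_independent
            (fun ia : 'I_n * 'I_(m n) => U n ia.1 ia.2)) ->
      P n (envy_free_event (U n)) @[n --> \oo] --> 1%E.
Proof.
(* The process needs [4 * B * n <= m], and [rounds_count] gives [B <= 12 * ln n / ln (ln n)]; hence
   [48 = 4 * 12]. *)
exists 48; split=> // m d T P D U ge_m DP lawU indU.
have q0 : 0 <= q by lra.
(* Once [ln (ln n)] reaches [A], it meets both lower bounds required by [rounds_count] for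
   [a = 256 * q]. *)
pose A := 1 + 3 * (256 * q).
have lower : \forall n \near \oo,
    ((1 - 4 * harmonic n)%:E <= P n (envy_free_event (U n)) <= 1)%E.
  near=> n; apply/andP; split; last first.
    by apply: probability_le1; exact: measurable_envy_free_event.
  have le_n : expR (expR A) <= n%:R by near: n; exact: nbhs_infty_ger.
  have n0R : 0 < n%:R :> R := lt_le_trans (expR_gt0 _) le_n.
  have le_L : expR A <= ln n%:R by rewrite -(@expRK R (expR A)) ler_ln ?posrE ?expR_gt0.
  have L0 : 0 < ln n%:R :> R := lt_le_trans (expR_gt0 _) le_L.
  have le_y : A <= ln (ln n%:R) by rewrite -(@expRK R A) ler_ln ?posrE ?expR_gt0.
  set y := ln (ln n%:R) in le_y.
  have ey : expR y = ln n%:R by rewrite lnK ?posrE.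
  rewrite /A in le_y; have [a0 y1 ay] : [/\ 0 <= 256 * q, 1 <= y & 3 * (256 * q) <= y].
    by split; lra.
  have [B [B0 aB leB eB]] := rounds_count a0 y1 ay.
  have n0 : (0 < n)%N by rewrite -(ltr0n R).
  have leBm : (4 * B * n <= m n)%N.
    rewrite -(ler_nat R); have : 48 * (n%:R * ln n%:R / y) <= (m n)%:R by rewrite /y; near: n; exact: ge_m.
    apply: le_trans; rewrite !natrM -ey.
    have := ler_wpM2r (ltW n0R) leB; lra.
  have B64 : 64 * q <= B%:R by lra.
  have D01 i : D n i `[0, 1]%classic = 1%E by have [[]] := DP n i.
  have Dq i z l : 0 <= l -> (D n i `[z, (z + l)%R[%classic <= (q * l)%R%:E)%E.
    by move=> l0; have [_ iD pD] := DP n i; exact: (pdf_bounded_itv z iD pD l0 q0).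
  apply: le_trans (one_instance n0 B0 leBm q0 B64 D01 Dq (lawU n) (indU n)).
  rewrite lee_fin lerD2l lerN2; apply: (error_bound n0).
    by apply: leq_trans leBm; rewrite -mulnA leq_mul2l leq_pmull.
  by move: eB; rewrite ey lnK ?posrE.
apply: (squeeze_cvge lower); last exact: cvg_cst.
have lim1 : (1 - 4 * harmonic n : R) @[n --> \oo] --> (1 - 4 * 0 : R).
  by apply: cvgB; [exact: cvg_cst|apply: cvgMl_tmp; exact: cvg_harmonic].
rewrite mulr0 subr0 in lim1; apply: cvg_EFin; last exact: lim1.
by near=> n.
Unshelve. all: by end_near. Qed.
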